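(* Let $f\in\mathcal{A}$, i.e. $f$ is analytic in $\Delta$ with $f(z)=z+a_2z^2+\cdots+a_nz^n+\cdots$, and suppose that $$\mathrm{Re}\left\{1+\frac{zf''(z)}{f'(z)}\right\}<\frac32\quad\text{for all } z\in\Delta.$$ Then $$\mathrm{Re}\left\{\frac{1}{f'(z)}\right\}>\frac12\quad\text{for all } z\in\Delta$$ and $$\left|f'(z)-1\right|<1\quad\text{for all } z\in\Delta.$$ The results are sharp for the function $f_0(z)=z+z^2/2$: that is, $f_0\in\mathcal{A}$ satisfies the hypothesis, $\inf_{z\in\Delta}\mathrm{Re}\{1/f_0'(z)\}=\frac12$ and $\sup_{z\in\Delta}|f_0'(z)-1|=1$.
   Context: $\Delta=\{z\in\mathbb{C}:|z|<1\}$ is the open unit disc. $\mathcal{A}$ is the class of functions $f$ analytic in $\Delta$ and normalized by $f(0)=0$, $f'(0)=1$, i.e. of the form $f(z)=z+a_2z^2+\cdots+a_nz^n+\cdots$. *)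

(* Defs.v *)
From Stdlib Require Import Reals.
From Coquelicot Require Import Coquelicot.
Open Scope R_scope.

Definition in_disc (z : C) : Prop := Cmod z < 1.

(* [f] is the sum of a convergent power series centred at [z0] on some
   neighbourhood of [z0]. *)
Definition analytic_at (f : C -> C) (z0 : C) : Prop :=
  exists (a : nat -> C) (r : R), 0 < r /\
    forall z : C, Cmod (z - z0)%C < r ->
      @is_pseries C_AbsRing C_NormedModule a (z - z0)%C (f z).

(* Functions are total on C; only their values on the disc matter, because
   the disc is open. *)
Definition classA (f : C -> C) : Prop :=
  (forall z : C, in_disc z -> analytic_at f z) /\
  f (RtoC 0) = RtoC 0 /\ C_derive f (RtoC 0) = RtoC 1.

(* 1 + z f''(z) / f'(z).  Division is total, with x / 0 = 0 in C, so where
   f'(z) = 0 this is 1; a bound on its real part therefore demands nothing at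
   zeros of f', which need not be excluded beforehand. *)
Definition convexity_quotient (f : C -> C) (z : C) : C :=
  (1 + z * C_derive (C_derive f) z / C_derive f z)%C.

Definition f0 (z : C) : C := (z + z ^ 2 / 2)%C.

(* Main.v *)
(* Write w = f' - 1 and w(z) = z phi(z), and suppose |w(zeta)| >= 1 for some
   zeta in the disc.  Fix |zeta| < r < 1 and maximise |phi|^2 + eps |z|^2 on
   |z| <= r.  The function is strictly subharmonic, so the maximum is attained at
   some z0 with |z0| = r, where |w(z0)| > 1 once eps is small.  The first-order
   conditions at z0 give z0 w'(z0) = k w(z0) with k real and k >= 1 - eps (an
   approximate form of Jack's lemma), hence
   Re (z0 f''(z0) / f'(z0)) = Re (k w / (1 + w)) >= 1/2, a contradiction.
   Keeping |w(z0)| > 1 strictly rules out f'(z0) = 0.  The bound on Re (1 / f')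
   is the image of the disc |f' - 1| < 1 under inversion. *)

Require Import Defs.
From Stdlib Require Import Reals Lra Lia Classical ClassicalEpsilon.
From Coquelicot Require Import Coquelicot.
Open Scope R_scope.

(** * Complex power series *)

(** Dividing [w] by [z] is what produces the bound on [k]: since [z w'/w = 1 + z phi'/phi], a
    boundary maximum of [|phi|] makes the last term real and nonnegative, and the extra [eps |z|^2]
    lowers this by at most [eps]. Analyticity supplies a separate series at each point, with no
    control over its radius; uniformity enters only through compactness of the closed disc. The
    slack comes from taking [r] strictly larger than [|zeta|]. Comparing [z0] with [zeta] gives
    [|w(z0)|^2 >= q - eps] with [q = (r/|zeta|)^2 > 1], even when [|w(zeta)|] is exactly 1. The
    excess [q - 1] pays for every loss caused by [eps]. *)

Lemma is_series_Cmod_le (a : nat -> C) (b : nat -> R) (l : C) (s : R) :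
  @is_series C_AbsRing C_NormedModule a l -> is_series b s ->
  (forall n, Cmod (a n) <= b n) -> Cmod l <= s.
Proof.
  intros Ha Hb Hab.
  apply (is_lim_seq_le (fun n => Cmod (sum_n a n)) (sum_n b) (Cmod l) s).
  - intros n. apply Rle_trans with (sum_n (fun k => Cmod (a k)) n).
    + exact (@norm_sum_n_m C_AbsRing C_NormedModule a 0 n).
    + unfold sum_n. apply sum_n_m_le. exact Hab.
  - apply (filterlim_comp _ _ _ (sum_n a) Cmod _ (locally l)).
    + exact Ha.
    + exact (@filterlim_norm C_AbsRing C_NormedModule l).
  - exact Hb.
Qed.

Lemma ex_series_square_geom (q : R) :
  0 < q < 1 -> ex_series (fun n => (INR n + 1) ^ 2 * q ^ n).
Proof.
  intros Hq.
  assert (Hpos : forall n, 0 < (INR n + 1) ^ 2 * q ^ n).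
  { intros n. apply Rmult_lt_0_compat; apply pow_lt; [|lra].
    pose proof (pos_INR n); lra. }
  apply ex_series_ext with (fun n => Rabs ((INR n + 1) ^ 2 * q ^ n)).
  { intros n. apply Rabs_pos_eq, Rlt_le, Hpos. }
  apply ex_series_DAlembert with q; [lra| |].
  { intros n. apply Rgt_not_eq, Hpos. }
  apply is_lim_seq_ext with (fun n => (1 + / INR (S n)) * (1 + / INR (S n)) * q).
  { intros n. rewrite Rabs_pos_eq.
    2:{ apply Rlt_le, Rdiv_lt_0_compat; apply Hpos. }
    rewrite S_INR. pose proof (pos_INR n). simpl. field. split; [|lra].
    apply pow_nonzero; lra. }
  replace q with ((1 + 0) * (1 + 0) * q) at 1 by ring.
  assert (H0 : is_lim_seq (fun n => / INR (S n)) 0).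
  { apply (is_lim_seq_incr_1 (fun n => / INR n)).
    apply (is_lim_seq_inv _ p_infty is_lim_seq_INR). discriminate. }
  assert (H1 : is_lim_seq (fun n => 1 + / INR (S n)) (1 + 0)).
  { apply is_lim_seq_plus'; [apply is_lim_seq_const|exact H0]. }
  apply is_lim_seq_mult'; [|apply is_lim_seq_const].
  apply is_lim_seq_mult'; exact H1.
Qed.

Lemma pow_n_Cpow (z : C) (n : nat) : @pow_n C_AbsRing z n = (z ^ n)%C.
Proof. induction n as [|n IH]; [reflexivity|simpl; now rewrite IH]. Qed.

Lemma is_pseries_C (a : nat -> C) (z l : C) :
  @is_pseries C_AbsRing C_NormedModule a z l <->
  @is_series C_AbsRing C_NormedModule (fun n => z ^ n * a n)%C l.
Proof.
  split; intros H; (eapply is_series_ext; [|exact H]);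
    intros n; rewrite pow_n_Cpow; reflexivity.
Qed.

(** The factor [rho] on the left stands for the missing power in [n rho^(n-1)]; this avoids both a
    division and a truncated predecessor in the induction. *)
Lemma Cmod_pow_sub_le (z w : C) (rho : R) (n : nat) :
  Cmod z <= rho -> Cmod w <= rho ->
  rho * Cmod (w ^ n - z ^ n)%C <= INR n * rho ^ n * Cmod (w - z)%C.
Proof.
  intros Hz Hw. pose proof (Cmod_ge_0 z) as Hz0.
  induction n as [|n IH].
  - simpl. replace (1 - 1)%C with (RtoC 0) by ring. rewrite Cmod_0. lra.
  - rewrite S_INR.
    replace (w ^ S n - z ^ S n)%C with (w * (w ^ n - z ^ n) + (w - z) * z ^ n)%C
      by (simpl; ring).
    eapply Rle_trans; [apply Rmult_le_compat_l; [lra|apply Cmod_triangle]|].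
    rewrite !Cmod_mult, Cmod_pow.
    assert (Hp : Cmod z ^ n <= rho ^ n) by (apply pow_incr; lra).
    pose proof (Cmod_ge_0 (w ^ n - z ^ n)%C). pose proof (Cmod_ge_0 (w - z)%C).
    assert (Cmod w * (rho * Cmod (w ^ n - z ^ n)%C)
            <= rho * (INR n * rho ^ n * Cmod (w - z)%C)).
    { apply Rmult_le_compat; try lra; [apply Cmod_ge_0|apply Rmult_le_pos; lra]. }
    assert (rho * (Cmod (w - z) * Cmod z ^ n) <= rho * (Cmod (w - z) * rho ^ n)).
    { apply Rmult_le_compat_l; [lra|]. now apply Rmult_le_compat_l. }
    simpl (rho ^ S n). lra.
Qed.

(** The remainder [D n] satisfies [D (n+1) = z D n + (w - z)(w^n - z^n)], so the previous bound
    drives the induction. The coefficient [n^2] is a convenient majorant of [n(n-1)/2], closed under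
    the step because [n^2 + n <= (n+1)^2]. *)
Lemma Cmod_pow_taylor1_le (z w : C) (rho : R) (n : nat) :
  Cmod z <= rho -> Cmod w <= rho ->
  rho ^ 2 * Cmod (w ^ n - z ^ n - INR n * z ^ pred n * (w - z))%C
    <= INR n ^ 2 * rho ^ n * Cmod (w - z)%C ^ 2.
Proof.
  intros Hz Hw. pose proof (Cmod_ge_0 z) as Hz0.
  induction n as [|n IH].
  - replace (w ^ 0 - z ^ 0 - INR 0 * z ^ pred 0 * (w - z))%C with (RtoC 0)
      by (simpl; ring).
    rewrite Cmod_0. simpl. lra.
  - rewrite S_INR.
    replace (w ^ S n - z ^ S n - (INR n + 1)%R * z ^ pred (S n) * (w - z))%C
      with (z * (w ^ n - z ^ n - INR n * z ^ pred n * (w - z))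
            + (w - z) * (w ^ n - z ^ n))%C.
    2:{ rewrite RtoC_plus. destruct n; simpl; ring. }
    set (D := (w ^ n - z ^ n - INR n * z ^ pred n * (w - z))%C) in *.
    eapply Rle_trans.
    { apply Rmult_le_compat_l; [apply pow2_ge_0|apply Cmod_triangle]. }
    rewrite !Cmod_mult.
    pose proof (Cmod_pow_sub_le z w rho n Hz Hw) as Hsub.
    pose proof (Cmod_ge_0 D). pose proof (Cmod_ge_0 (w - z)%C).
    pose proof (pow2_ge_0 rho). pose proof (pos_INR n).
    assert (0 <= rho ^ n) by (apply pow_le; lra).
    assert (HA : Cmod z * (rho ^ 2 * Cmod D)
            <= rho * (INR n ^ 2 * rho ^ n * Cmod (w - z)%C ^ 2)).
    { apply Rmult_le_compat; try lra. now apply Rmult_le_pos. }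
    assert (HB : rho * Cmod (w - z)%C * (rho * Cmod (w ^ n - z ^ n)%C)
            <= rho * Cmod (w - z)%C * (INR n * rho ^ n * Cmod (w - z)%C)).
    { apply Rmult_le_compat_l; [apply Rmult_le_pos; lra|exact Hsub]. }
    assert (0 <= rho * rho ^ n * Cmod (w - z)%C ^ 2).
    { apply Rmult_le_pos; [apply Rmult_le_pos; lra|apply pow2_ge_0]. }
    simpl (rho ^ S n). nra.
Qed.

(** A term of a convergent series is a difference of two consecutive partial sums, and these are
    bounded; hence the bound [B + B]. *)
Lemma pseries_coef_bound (a : nat -> C) (rho : R) (l : C) :
  0 <= rho -> @is_pseries C_AbsRing C_NormedModule a (RtoC rho) l ->
  exists B, forall n, Cmod (a n) * rho ^ n <= B.
Proof.
  intros Hrho Hl. apply is_pseries_C in Hl.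
  destruct (@filterlim_bounded C_AbsRing C_NormedModule
              (sum_n (fun n => RtoC rho ^ n * a n)%C)
              (ex_intro _ l Hl)) as [B HB].
  exists (B + B). intros n.
  replace (Cmod (a n) * rho ^ n) with (Cmod (RtoC rho ^ n * a n)%C).
  2:{ rewrite Cmod_mult, Cmod_pow, Cmod_R, Rabs_pos_eq by lra. ring. }
  destruct n as [|n].
  - pose proof (HB 0%nat) as H. rewrite sum_O in H.
    change (Cmod (RtoC rho ^ 0 * a 0%nat)%C <= B) in H.
    pose proof (Cmod_ge_0 (RtoC rho ^ 0 * a 0%nat)%C). lra.
  - pose proof (HB n) as H0. pose proof (HB (S n)) as H1.
    rewrite sum_Sn in H1.
    set (s := sum_n (fun n => RtoC rho ^ n * a n)%C n) in *.
    set (x := (RtoC rho ^ S n * a (S n))%C) in *.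
    change (Cmod s <= B) in H0. change (Cmod (s + x)%C <= B) in H1.
    replace x with ((s + x) + - s)%C by ring.
    eapply Rle_trans; [apply Cmod_triangle|]. rewrite Cmod_opp. lra.
Qed.

(* Coquelicot's lemmas type complex numbers as elements of [C_NormedModule],
   where [ring] finds no ring structure. *)
Ltac C_ring :=
  match goal with |- @eq _ ?x ?y => change (@eq C x y); simpl; ring end.

(** All derivatives below are computed through this criterion, which confines filters to one proof.
    [M] may have any sign, hence [Rabs M + 1] as a positive divisor. *)
Lemma C_derive_of_quadratic_error (f : C -> C) (z l : C) (M d : R) :
  0 < d ->
  (forall w, Cmod (w - z)%C < d ->
     Cmod (f w - f z - l * (w - z))%C <= M * Cmod (w - z)%C ^ 2) ->
  C_derive f z = l.
Proof.
  intros Hd H. apply is_C_derive_unique. split.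
  { apply is_linear_scal_l. }
  intros x Hx.
  apply (is_filter_lim_locally_unique (V := AbsRing_NormedModule C_AbsRing)) in Hx. subst x.
  intros eps.
  assert (HM : 0 < Rabs M + 1) by (pose proof (Rabs_pos M); lra).
  assert (He : 0 < Rmin d (eps / (Rabs M + 1))).
  { apply Rmin_pos; [exact Hd|]. apply Rdiv_lt_0_compat; [apply cond_pos|exact HM]. }
  exists (mkposreal _ He). intros w Hw.
  change (Cmod (w - z)%C < Rmin d (eps / (Rabs M + 1))) in Hw.
  change (Cmod (f w - f z - (w - z) * l)%C <= eps * Cmod (w - z)%C).
  replace ((w - z) * l)%C with (l * (w - z))%C by ring.
  assert (Hw1 : Cmod (w - z)%C < d) by (eapply Rlt_le_trans; [exact Hw|apply Rmin_l]).
  assert (Hw2 : (Rabs M + 1) * Cmod (w - z)%C <= eps).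
  { apply Rlt_le in Hw.
    assert (Hw' : Cmod (w - z)%C <= eps / (Rabs M + 1))
      by (eapply Rle_trans; [exact Hw|apply Rmin_r]).
    apply (Rmult_le_compat_l (Rabs M + 1)) in Hw'; [|lra].
    replace ((Rabs M + 1) * (eps / (Rabs M + 1))) with (pos eps) in Hw'
      by (field; lra). exact Hw'. }
  eapply Rle_trans; [apply (H w Hw1)|].
  pose proof (Cmod_ge_0 (w - z)%C). pose proof (Rle_abs M). nra.
Qed.

Definition pseries_derive (a : nat -> C) (n : nat) : C := (INR (S n) * a (S n))%C.

(** Termwise differentiation: the first-order remainders of the monomials, weighted by [a n], sum to
    at most a constant times [|w - z|^2], and the quadratic-error criterion applies. *)
Lemma is_pseries_C_derive (f : C -> C) (a : nat -> C) (z0 : C) (r : R) :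
  (forall z, Cmod (z - z0)%C < r ->
     @is_pseries C_AbsRing C_NormedModule a (z - z0)%C (f z)) ->
  forall z, Cmod (z - z0)%C < r ->
    @is_pseries C_AbsRing C_NormedModule (pseries_derive a) (z - z0)%C (C_derive f z).
Proof.
  intros Hf z Hz. set (x := (z - z0)%C) in *.
  pose proof (Cmod_ge_0 x) as Hx0.
  (* Two radii are needed: [rho > |x|] leaves room for nearby points, and [sigma > rho] turns
     bounded coefficients into decay like [q^n] with [q = rho / sigma]. *)
  set (rho := (Cmod x + r) / 2). set (sigma := (rho + r) / 2).
  assert (Hrho : Cmod x < rho /\ 0 < rho < sigma /\ sigma < r)
    by (unfold sigma, rho; lra).
  destruct Hrho as (Hxr & Hrs & Hsr).
  assert (Hs : @is_pseries C_AbsRing C_NormedModule a (RtoC sigma) (f (z0 + sigma)%C)).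
  { replace (RtoC sigma) with ((z0 + sigma) - z0)%C at 1 by ring. apply Hf.
    replace ((z0 + sigma) - z0)%C with (RtoC sigma) by ring.
    rewrite Cmod_R, Rabs_pos_eq; lra. }
  destruct (pseries_coef_bound a sigma _ ltac:(lra) Hs) as [B HB].
  set (q := rho / sigma).
  assert (Hq : 0 < q < 1).
  { unfold q. split; [apply Rdiv_lt_0_compat; lra|].
    apply Rlt_div_l; lra. }
  destruct (ex_series_square_geom q Hq) as [sum HS].
  assert (HB0 : 0 <= B).
  { eapply Rle_trans; [|apply (HB 0%nat)]. simpl.
    pose proof (Cmod_ge_0 (a 0%nat)); lra. }
  assert (Ha : forall n, Cmod (a n) * rho ^ n <= B * q ^ n).
  { intros n. replace (rho ^ n) with (sigma ^ n * q ^ n).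
    2:{ rewrite <- Rpow_mult_distr. f_equal. unfold q. field. lra. }
    rewrite <- Rmult_assoc. apply Rmult_le_compat_r; [apply pow_le; lra|apply HB]. }
  (* The weight [(n+1)^2] dominates both the [n] of the derived series and the [n^2] of the
     remainders, so one convergent majorant serves twice. *)
  assert (Hn : forall n, INR n ^ 2 <= (INR n + 1) ^ 2
                         /\ INR n <= (INR n + 1) ^ 2).
  { intros n. pose proof (pos_INR n). split; nra. }
  assert (Hex : @ex_series C_AbsRing C_NormedModule
                  (fun n => INR n * x ^ pred n * a n)%C).
  { apply (@ex_series_le C_AbsRing C_CompleteNormedModule _
             (fun n => B / rho * ((INR n + 1) ^ 2 * q ^ n))).
    2:{ exists (B / rho * sum). exact (is_series_scal_l (B / rho) _ _ HS). }
    intros n. change (Cmod (INR n * x ^ pred n * a n)%C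
                      <= B / rho * ((INR n + 1) ^ 2 * q ^ n)).
    rewrite !Cmod_mult, Cmod_pow, Cmod_R, Rabs_pos_eq by apply pos_INR.
    apply Rmult_le_reg_l with rho; [lra|].
    replace (rho * (B / rho * ((INR n + 1) ^ 2 * q ^ n)))
      with ((INR n + 1) ^ 2 * (B * q ^ n)) by (field; lra).
    apply Rle_trans with (INR n * (Cmod (a n) * rho ^ n)).
    { destruct n as [|n]; [simpl; lra|].
      assert (Cmod x ^ n <= rho ^ n) by (apply pow_incr; lra).
      pose proof (pos_INR (S n)). pose proof (Cmod_ge_0 (a (S n))).
      simpl (pred (S n)). simpl (rho ^ S n).
      assert (0 <= rho * INR (S n) * Cmod (a (S n)))
        by (repeat apply Rmult_le_pos; lra).
      nra. }
    apply Rmult_le_compat; [apply pos_INR| |apply Hn|apply Ha].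
    apply Rmult_le_pos; [apply Cmod_ge_0|apply pow_le; lra]. }
  destruct Hex as [l Hl]. change C in l.
  assert (Hd : C_derive f z = l).
  { apply C_derive_of_quadratic_error with (B / rho ^ 2 * sum) (rho - Cmod x); [lra|].
    intros w Hw. set (y := (w - z0)%C).
    assert (Hyx : (w - z)%C = (y - x)%C) by (unfold x, y; ring).
    assert (Hy : Cmod y < rho).
    { replace y with ((w - z) + x)%C by (rewrite Hyx; ring).
      eapply Rle_lt_trans; [apply Cmod_triangle|lra]. }
    rewrite Hyx.
    apply is_series_Cmod_le with
      (fun n => (y ^ n - x ^ n - INR n * x ^ pred n * (y - x)) * a n)%C
      (fun n => B / rho ^ 2 * Cmod (y - x)%C ^ 2 * ((INR n + 1) ^ 2 * q ^ n)).
    - assert (Hfw : @is_pseries C_AbsRing C_NormedModule a y (f w))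
        by (apply Hf; fold y; lra).
      pose proof (Hf z Hz) as Hfz. fold x in Hfz.
      apply is_pseries_C in Hfw. apply is_pseries_C in Hfz.
      pose proof (is_series_minus _ _ _ _ (is_series_minus _ _ _ _ Hfw Hfz)
        (is_series_scal_l (y - x)%C _ _ Hl)) as H.
      replace (f w - f z - l * (y - x))%C with (f w - f z - (y - x) * l)%C by ring.
      eapply is_series_ext; [|exact H].
      intros n.
      change ((y ^ n * a n - x ^ n * a n - (y - x) * (INR n * x ^ pred n * a n))%C
        = ((y ^ n - x ^ n - INR n * x ^ pred n * (y - x)) * a n)%C). ring.
    - replace (B / rho ^ 2 * sum * Cmod (y - x)%C ^ 2)
        with (B / rho ^ 2 * Cmod (y - x)%C ^ 2 * sum) by ring.
      exact (is_series_scal_l (B / rho ^ 2 * Cmod (y - x)%C ^ 2) _ _ HS).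
    - intros n. rewrite Cmod_mult.
      assert (Hr2 : 0 < rho ^ 2) by (apply pow_lt; lra).
      apply Rmult_le_reg_l with (rho ^ 2); [exact Hr2|].
      replace (rho ^ 2 * (B / rho ^ 2 * Cmod (y - x)%C ^ 2
                 * ((INR n + 1) ^ 2 * q ^ n)))
        with (Cmod (y - x)%C ^ 2 * ((INR n + 1) ^ 2 * (B * q ^ n))) by (field; lra).
      rewrite <- Rmult_assoc.
      eapply Rle_trans.
      { apply Rmult_le_compat_r; [apply Cmod_ge_0|].
        apply Cmod_pow_taylor1_le; lra. }
      replace (INR n ^ 2 * rho ^ n * Cmod (y - x)%C ^ 2 * Cmod (a n))
        with (Cmod (y - x)%C ^ 2 * (INR n ^ 2 * (Cmod (a n) * rho ^ n))) by ring.
      apply Rmult_le_compat_l; [apply pow2_ge_0|].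
      apply Rmult_le_compat; [apply pow2_ge_0| |apply Hn|apply Ha].
      apply Rmult_le_pos; [apply Cmod_ge_0|apply pow_le; lra]. }
  rewrite Hd. apply is_pseries_C.
  assert (Hl' : @is_series C_AbsRing C_NormedModule
    (fun n => INR (S n) * x ^ pred (S n) * a (S n))%C l).
  { apply (@is_series_incr_1 C_AbsRing C_NormedModule
             (fun n => INR n * x ^ pred n * a n)%C).
    change (@is_series C_AbsRing C_NormedModule
             (fun n => INR n * x ^ pred n * a n)%C (l + INR 0 * x ^ pred 0 * a 0%nat)%C).
    replace (l + INR 0 * x ^ pred 0 * a 0%nat)%C with l by C_ring.
    exact Hl. }
  eapply is_series_ext; [|exact Hl'].
  intros n. unfold pseries_derive. C_ring.
Qed.

Lemma analytic_at_C_derive (f : C -> C) (z : C) :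
  analytic_at f z -> analytic_at (C_derive f) z.
Proof.
  intros (a & r & Hr & Hf). exists (pseries_derive a), r. split; [exact Hr|].
  now apply is_pseries_C_derive.
Qed.

(* Removing the constant term of a power series divides its sum by the variable. *)
Lemma is_pseries_shift (a : nat -> C) (h l : C) :
  h <> RtoC 0 -> @is_pseries C_AbsRing C_NormedModule a h l ->
  @is_pseries C_AbsRing C_NormedModule (fun n => a (S n)) h ((l - a 0%nat) / h)%C.
Proof.
  intros Hh Hl. apply is_pseries_C in Hl. apply is_pseries_C.
  assert (H : @is_series C_AbsRing C_NormedModule
                (fun n => h ^ S n * a (S n))%C (l - a 0%nat)%C).
  { apply (@is_series_incr_1 C_AbsRing C_NormedModule (fun n => h ^ n * a n)%C).
    change (@is_series C_AbsRing C_NormedModule (fun n => h ^ n * a n)%C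
              (l - a 0%nat + h ^ 0 * a 0%nat)%C).
    replace (l - a 0%nat + h ^ 0 * a 0%nat)%C with l by C_ring. exact Hl. }
  pose proof (is_series_scal_l (/ h)%C _ _ H) as H'.
  replace ((l - a 0%nat) / h)%C with (/ h * (l - a 0%nat))%C by (unfold Cdiv; C_ring).
  eapply is_series_ext; [|exact H'].
  intros n. change ((/ h * (h ^ S n * a (S n)))%C = (h ^ n * a (S n))%C).
  simpl. field. exact Hh.
Qed.

Lemma is_pseries_at_0 (a : nat -> C) :
  @is_pseries C_AbsRing C_NormedModule a (RtoC 0) (a 0%nat).
Proof.
  apply is_pseries_C.
  apply (@is_series_decr_1 C_AbsRing C_NormedModule).
  change (@is_series C_AbsRing C_NormedModule
            (fun k => RtoC 0 ^ S k * a (S k))%C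
            (a 0%nat + - (RtoC 0 ^ 0 * a 0%nat))%C).
  replace (a 0%nat + - (RtoC 0 ^ 0 * a 0%nat))%C with (RtoC 0) by C_ring.
  eapply is_series_ext with (a := fun _ => RtoC 0).
  { intros n. C_ring. }
  apply (filterlim_ext (fun _ => RtoC 0)).
  { intros n. symmetry. apply (sum_n_m_const_zero (G := C_AbelianGroup)). }
  apply filterlim_const.
Qed.

Lemma is_pseries_unique (a : nat -> C) (h l l' : C) :
  @is_pseries C_AbsRing C_NormedModule a h l ->
  @is_pseries C_AbsRing C_NormedModule a h l' -> l = l'.
Proof.
  intros Hl Hl'. apply is_pseries_C in Hl, Hl'.
  exact (filterlim_locally_unique (K := C_AbsRing) (V := C_NormedModule)
           (sum_n (fun n => h ^ n * a n)%C) l l' Hl Hl').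
Qed.

Lemma pseries_bounded (a : nat -> C) (rho sigma : R) (l : C) :
  0 <= rho < sigma -> @is_pseries C_AbsRing C_NormedModule a (RtoC sigma) l ->
  exists M, forall h s, Cmod h <= rho ->
    @is_pseries C_AbsRing C_NormedModule a h s -> Cmod s <= M.
Proof.
  intros Hrs Hl. destruct (pseries_coef_bound a sigma l ltac:(lra) Hl) as [B HB].
  set (q := rho / sigma).
  assert (Hq : 0 <= q < 1).
  { unfold q. split; [apply Rdiv_le_0_compat; lra|]. apply Rlt_div_l; lra. }
  exists (B * / (1 - q)). intros h s Hh Hs. apply is_pseries_C in Hs.
  apply (is_series_Cmod_le _ (fun n => B * q ^ n) _ _ Hs).
  - apply (is_series_scal_l B (fun n => q ^ n)). apply is_series_geom.
    rewrite Rabs_pos_eq; lra.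
  - intros n. rewrite Cmod_mult, Cmod_pow.
    apply Rle_trans with (rho ^ n * Cmod (a n)).
    { apply Rmult_le_compat_r; [apply Cmod_ge_0|].
      apply pow_incr. split; [apply Cmod_ge_0|exact Hh]. }
    replace (rho ^ n) with (sigma ^ n * q ^ n).
    2:{ rewrite <- Rpow_mult_distr. f_equal. unfold q. field. lra. }
    replace (sigma ^ n * q ^ n * Cmod (a n)) with (Cmod (a n) * sigma ^ n * q ^ n)
      by ring.
    apply Rmult_le_compat_r; [apply pow_le; lra|apply HB].
Qed.

(** * Second-order Taylor expansions *)

(** Expansions are recorded instead of analyticity because they pass to [phi = w / z] by dividing
    polynomials, with no power series for a quotient. The cubic remainder is what the second-order
    argument at interior points requires. *)
Definition taylor2 (f : C -> C) (z c0 c1 c2 : C) : Prop :=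
  exists M d, 0 < d /\ forall h, Cmod h < d ->
    Cmod (f (z + h) - (c0 + c1 * h + c2 * h * h))%C <= M * Cmod h ^ 3.

(** Three shifts show that the remainder divided by [h^3] is itself the sum of a power series, hence
    bounded on a smaller disc. *)
Lemma analytic_taylor2 (f : C -> C) (z : C) :
  analytic_at f z -> exists c0 c1 c2, taylor2 f z c0 c1 c2.
Proof.
  intros (a & r & Hr & Hf). exists (a 0%nat), (a 1%nat), (a 2%nat).
  assert (Hshift : forall h, h <> RtoC 0 -> Cmod h < r ->
    @is_pseries C_AbsRing C_NormedModule (fun n => a (S (S (S n)))) h
      ((f (z + h) - (a 0%nat + a 1%nat * h + a 2%nat * h * h)) / (h * h * h))%C).
  { intros h Hh Hhr.
    assert (H0 : @is_pseries C_AbsRing C_NormedModule a h (f (z + h)%C)).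
    { replace h with ((z + h) - z)%C at 1 by ring. apply Hf.
      now replace ((z + h) - z)%C with h by ring. }
    apply is_pseries_shift in H0; [|exact Hh].
    apply is_pseries_shift in H0; [|exact Hh].
    apply is_pseries_shift in H0; [|exact Hh].
    match type of H0 with is_pseries _ _ ?u =>
      match goal with |- is_pseries _ _ ?v => replace v with u; [exact H0|] end end.
    field. exact Hh. }
  assert (Hr2 : RtoC (r / 2) <> RtoC 0).
  { intros E. apply RtoC_inj in E. lra. }
  pose proof (Hshift (RtoC (r / 2)) Hr2) as H2.
  rewrite Cmod_R, Rabs_pos_eq in H2 by lra. specialize (H2 ltac:(lra)).
  destruct (pseries_bounded _ (r / 4) (r / 2) _ ltac:(lra) H2) as [M HM].
  exists M, (r / 4). split; [lra|]. intros h Hh.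
  destruct (Ceq_dec h 0) as [->|Hh0].
  - rewrite Cmod_0.
    assert (H0 : f (z + 0)%C = a 0%nat).
    { pose proof (Hf z) as H0. replace (z - z)%C with (RtoC 0) in H0 by ring.
      rewrite Cmod_0 in H0. specialize (H0 Hr). replace (z + 0)%C with z by ring.
      exact (is_pseries_unique _ _ _ _ H0 (is_pseries_at_0 a)). }
    rewrite H0. replace (_ - _)%C with (RtoC 0) by ring. rewrite Cmod_0. lra.
  - pose proof (HM h _ (Rlt_le _ _ Hh) (Hshift h Hh0 ltac:(lra))) as H.
    assert (Hp : 0 < Cmod h) by (now apply Cmod_gt_0).
    assert (Hhhh : (h * h * h)%C <> RtoC 0) by (repeat apply Cmult_neq_0; exact Hh0).
    rewrite Cmod_div, !Cmod_mult in H by exact Hhhh.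
    apply Rle_div_l in H; [|repeat apply Rmult_lt_0_compat; exact Hp].
    replace (Cmod h ^ 3) with (Cmod h * Cmod h * Cmod h) by ring. exact H.
Qed.

Lemma taylor2_value (f : C -> C) (z c0 c1 c2 : C) :
  taylor2 f z c0 c1 c2 -> f z = c0.
Proof.
  intros (M & d & Hd & H). specialize (H (RtoC 0)). rewrite Cmod_0 in H.
  specialize (H Hd). replace (M * 0 ^ 3) with 0 in H by ring.
  replace (z + 0)%C with z in H by ring.
  assert (E : (f z - (c0 + c1 * 0 + c2 * 0 * 0))%C = 0).
  { apply Cmod_eq_0, Rle_antisym; [exact H|apply Cmod_ge_0]. }
  replace (f z) with ((f z - (c0 + c1 * 0 + c2 * 0 * 0)) + c0)%C by ring.
  rewrite E. ring.
Qed.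

Lemma taylor2_first_order (f : C -> C) (z c0 c1 c2 : C) :
  taylor2 f z c0 c1 c2 ->
  exists M d, 0 <= M /\ 0 < d <= 1 /\ forall h, Cmod h < d ->
    Cmod (f (z + h) - (c0 + c1 * h))%C <= M * Cmod h ^ 2.
Proof.
  intros (M & d & Hd & H). exists (Cmod c2 + Rabs M), (Rmin d 1).
  pose proof (Cmod_ge_0 c2). pose proof (Rabs_pos M). pose proof (Rle_abs M).
  split; [lra|]. split.
  { split; [apply Rmin_pos; lra|apply Rmin_r]. }
  intros h Hh. pose proof (Rmin_l d 1). pose proof (Rmin_r d 1).
  specialize (H h ltac:(lra)).
  replace (f (z + h) - (c0 + c1 * h))%C
    with ((f (z + h) - (c0 + c1 * h + c2 * h * h)) + c2 * h * h)%C by ring.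
  eapply Rle_trans; [apply Cmod_triangle|]. rewrite !Cmod_mult.
  pose proof (Cmod_ge_0 h). set (x := Cmod h) in *.
  assert (0 <= x ^ 2) by apply pow2_ge_0.
  assert (M * x ^ 3 <= Rabs M * x ^ 2).
  { replace (M * x ^ 3) with (M * x * x ^ 2) by ring.
    apply Rmult_le_compat_r; [assumption|]. nra. }
  nra.
Qed.

Lemma taylor2_C_derive (f : C -> C) (z c0 c1 c2 : C) :
  taylor2 f z c0 c1 c2 -> C_derive f z = c1.
Proof.
  intros H. rewrite <- (taylor2_value _ _ _ _ _ H) in H.
  destruct (taylor2_first_order _ _ _ _ _ H) as (M & d & _ & Hd & HM).
  apply C_derive_of_quadratic_error with M d; [lra|].
  intros w Hw. specialize (HM _ Hw). replace (z + (w - z))%C with w in HM by ring.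
  replace (f w - f z - c1 * (w - z))%C with (f w - (f z + c1 * (w - z)))%C by ring.
  exact HM.
Qed.

(** The coefficients solve [d0 z = c0], [d1 z + d0 = c1], [d2 z + d1 = c2]. Multiplying back by
    [z + h] leaves only the extra term [d2 h^3], and [|z + h| >= |z|/2] permits the division. *)
Lemma taylor2_quotient (f g : C -> C) (z c0 c1 c2 : C) :
  z <> RtoC 0 -> (forall w, f w = g w * w)%C -> taylor2 f z c0 c1 c2 ->
  exists d2, taylor2 g z (c0 / z)%C ((c1 - c0 / z) / z)%C d2.
Proof.
  intros Hz Hfg (M & d & Hd & H).
  set (d0 := (c0 / z)%C). set (d1 := ((c1 - d0) / z)%C). set (d2 := ((c2 - d1) / z)%C).
  assert (Hz0 : 0 < Cmod z) by (now apply Cmod_gt_0).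
  exists d2, ((M + Cmod d2) * (2 / Cmod z)), (Rmin d (Cmod z / 2)).
  split; [apply Rmin_pos; lra|]. intros h Hh.
  pose proof (Rmin_l d (Cmod z / 2)). pose proof (Rmin_r d (Cmod z / 2)).
  specialize (H h ltac:(lra)). rewrite Hfg in H.
  set (e := (g (z + h) - (d0 + d1 * h + d2 * h * h))%C).
  assert (E : (e * (z + h) = (g (z + h) * (z + h) - (c0 + c1 * h + c2 * h * h))
                             + - (d2 * (h * h * h)))%C).
  { unfold e, d2, d1, d0. field. exact Hz. }
  assert (Hzh : Cmod z / 2 <= Cmod (z + h)%C).
  { pose proof (Cmod_triangle (z + h) (- h)) as T.
    replace (z + h + - h)%C with z in T by ring. rewrite Cmod_opp in T. lra. }
  assert (Hle : Cmod e * Cmod (z + h)%C <= (M + Cmod d2) * Cmod h ^ 3).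
  { rewrite <- Cmod_mult, E. eapply Rle_trans; [apply Cmod_triangle|].
    rewrite Cmod_opp, !Cmod_mult. simpl in *. lra. }
  assert (Cmod e * (Cmod z / 2) <= (M + Cmod d2) * Cmod h ^ 3).
  { eapply Rle_trans; [|exact Hle]. apply Rmult_le_compat_l; [apply Cmod_ge_0|exact Hzh]. }
  apply Rmult_le_reg_r with (Cmod z / 2); [lra|].
  replace ((M + Cmod d2) * (2 / Cmod z) * Cmod h ^ 3 * (Cmod z / 2))
    with ((M + Cmod d2) * Cmod h ^ 3) by (field; lra).
  assumption.
Qed.

(** * Squared moduli along a Taylor expansion *)

Lemma Cmod_square_ge (u v : C) :
  Cmod u ^ 2 >= Cmod v ^ 2 - 2 * Cmod v * Cmod (u - v)%C.
Proof.
  assert (Cmod v <= Cmod u + Cmod (u - v)%C).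
  { replace v with (u + - (u - v))%C at 1 by ring.
    eapply Rle_trans; [apply Cmod_triangle|]. rewrite Cmod_opp. lra. }
  pose proof (Cmod_ge_0 u). pose proof (Cmod_ge_0 v).
  pose proof (Cmod_ge_0 (u - v)%C).
  (* If [|v| <= |u - v|] the lower bound is nonpositive; otherwise the triangle inequality has
     nonnegative sides and can be squared. *)
  destruct (Rle_lt_dec (Cmod v) (Cmod (u - v)%C)); nra.
Qed.

Lemma Cmod_square_plus (u v : C) :
  Cmod (u + v)%C ^ 2 = Cmod u ^ 2 + 2 * Re (Cconj u * v)%C + Cmod v ^ 2.
Proof.
  rewrite !Cmod2_alt. destruct u as [a b], v as [c d]. unfold Re, Im; simpl. ring.
Qed.

Lemma taylor2_Cmod_square_ge (f : C -> C) (z c0 c1 c2 : C) :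
  taylor2 f z c0 c1 c2 ->
  exists M d, 0 < d /\ forall h, Cmod h < d ->
    Cmod c0 ^ 2 + 2 * Re (Cconj c0 * c1 * h)%C - M * Cmod h ^ 2
      <= Cmod (f (z + h)%C) ^ 2.
Proof.
  intros H. destruct (taylor2_first_order _ _ _ _ _ H) as (M & d & HM0 & Hd & HM).
  exists (2 * (Cmod c0 + Cmod c1) * M), d. split; [lra|]. intros h Hh.
  specialize (HM h Hh).
  pose proof (Cmod_square_ge (f (z + h)%C) (c0 + c1 * h)%C) as H1.
  rewrite Cmod_square_plus in H1.
  replace (Cconj c0 * c1 * h)%C with (Cconj c0 * (c1 * h))%C by ring.
  assert (H2 : Cmod (c0 + c1 * h)%C <= Cmod c0 + Cmod c1).
  { eapply Rle_trans; [apply Cmod_triangle|]. rewrite Cmod_mult.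
    pose proof (Cmod_ge_0 c1). nra. }
  pose proof (pow2_ge_0 (Cmod (c1 * h)%C)).
  assert (Cmod (c0 + c1 * h)%C * Cmod (f (z + h) - (c0 + c1 * h))%C
          <= (Cmod c0 + Cmod c1) * (M * Cmod h ^ 2)).
  { apply Rmult_le_compat; try apply Cmod_ge_0; assumption. }
  lra.
Qed.

(** This is upper semicontinuity of [|f|^2], the half of continuity that makes a maximum attained.
    The constant [B] comes from expanding [(|c0| + A x)^2] with [x^2 <= x]. *)
Lemma taylor2_Cmod_square_lt (f : C -> C) (z c0 c1 c2 : C) (e : R) :
  taylor2 f z c0 c1 c2 -> 0 < e ->
  exists d, 0 < d /\ forall h, Cmod h < d -> Cmod (f (z + h)%C) ^ 2 < Cmod c0 ^ 2 + e.
Proof.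
  intros H He. destruct (taylor2_first_order _ _ _ _ _ H) as (M & d & HM0 & Hd & HM).
  set (A := Cmod c1 + M). pose proof (Cmod_ge_0 c0). pose proof (Cmod_ge_0 c1).
  assert (HA : 0 <= A) by (unfold A; lra).
  set (B := 2 * Cmod c0 * A + A ^ 2 + 1).
  assert (HB : 1 <= B).
  { unfold B. pose proof (Rmult_le_pos _ _ H0 HA). pose proof (pow2_ge_0 A). lra. }
  exists (Rmin d (e / B)). split.
  { apply Rmin_pos; [lra|]. apply Rdiv_lt_0_compat; lra. }
  intros h Hh. pose proof (Rmin_l d (e / B)). pose proof (Rmin_r d (e / B)).
  specialize (HM h ltac:(lra)). set (x := Cmod h) in *.
  assert (Hx : 0 <= x) by apply Cmod_ge_0.
  assert (HxB : x * B < e) by (apply (Rlt_div_r x e B); lra).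
  assert (Hf : Cmod (f (z + h)%C) <= Cmod c0 + A * x).
  { replace (f (z + h)%C) with (c0 + (c1 * h + (f (z + h) - (c0 + c1 * h))))%C by ring.
    eapply Rle_trans; [apply Cmod_triangle|].
    apply Rplus_le_compat_l.
    eapply Rle_trans; [apply Cmod_triangle|]. rewrite Cmod_mult. fold x.
    unfold A. assert (M * x ^ 2 <= M * x) by (apply Rmult_le_compat_l; nra). lra. }
  pose proof (Cmod_ge_0 (f (z + h)%C)).
  assert (Cmod (f (z + h)%C) ^ 2 <= (Cmod c0 + A * x) ^ 2) by (apply pow_incr; lra).
  assert (x ^ 2 <= x) by nra.
  assert (A ^ 2 * x ^ 2 <= A ^ 2 * x) by (apply Rmult_le_compat_l; [apply pow2_ge_0|lra]).
  unfold B in HxB. nra.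
Qed.

(** * Maxima of |f|^2 + eps |z|^2 *)

(* Averaging over the four directions [t, -t, i t, -i t] cancels the harmonic
   part of the Taylor polynomial and leaves the gain [4 t^2] of [|z|^2]. *)
Lemma no_interior_max (f : C -> C) (z c0 c1 c2 : C) (eps d : R) :
  taylor2 f z c0 c1 c2 -> 0 < eps -> 0 < d ->
  exists h, Cmod h < d /\
    Cmod (f z) ^ 2 + eps * Cmod z ^ 2
      < Cmod (f (z + h)%C) ^ 2 + eps * Cmod (z + h)%C ^ 2.
Proof.
  intros HT He Hd. pose proof (taylor2_value _ _ _ _ _ HT) as Hv.
  destruct HT as (M & d' & Hd' & HM).
  set (B := Cmod c0 + Cmod c1 + Cmod c2).
  assert (HB : 0 <= B).
  { unfold B. pose proof (Cmod_ge_0 c0). pose proof (Cmod_ge_0 c1).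
    pose proof (Cmod_ge_0 c2). lra. }
  (* In each direction the remainder costs at most [(A - 1) t^3], so [A t < eps] keeps the total
     cost below the gain [4 eps t^2]. *)
  set (A := 2 * B * Rabs M + 1).
  assert (HA : 0 < A).
  { unfold A. pose proof (Rmult_le_pos _ _ HB (Rabs_pos M)). lra. }
  assert (Ht : exists t, 0 < t /\ t < d /\ t < d' /\ t < 1 /\ A * t < eps).
  { set (t := Rmin (Rmin d d') (Rmin 1 (eps / A)) / 2).
    assert (0 < Rmin (Rmin d d') (Rmin 1 (eps / A))).
    { repeat apply Rmin_pos; try lra. apply Rdiv_lt_0_compat; lra. }
    pose proof (Rmin_l (Rmin d d') (Rmin 1 (eps / A))).
    pose proof (Rmin_r (Rmin d d') (Rmin 1 (eps / A))).
    pose proof (Rmin_l d d'). pose proof (Rmin_r d d').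
    pose proof (Rmin_l 1 (eps / A)). pose proof (Rmin_r 1 (eps / A)).
    exists t. unfold t. repeat split; try lra.
    rewrite Rmult_comm. apply (Rlt_div_r _ eps A); lra. }
  destruct Ht as (t & Ht0 & Htd & Htd' & Ht1 & HtA).
  assert (Hdir : forall h, Cmod h = t ->
    Cmod (c0 + c1 * h + c2 * h * h)%C ^ 2 + eps * Cmod (z + h)%C ^ 2
      <= Cmod (f (z + h)%C) ^ 2 + eps * Cmod (z + h)%C ^ 2 + (A - 1) * t ^ 3).
  { intros h Hh. specialize (HM h ltac:(lra)).
    set (p := (c0 + c1 * h + c2 * h * h)%C) in *.
    pose proof (Cmod_square_ge (f (z + h)%C) p) as H1.
    assert (Hp : Cmod p <= B).
    { unfold p, B. eapply Rle_trans; [apply Cmod_triangle|].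
      eapply Rle_trans; [apply Rplus_le_compat_r, Cmod_triangle|].
      rewrite !Cmod_mult, Hh.
      pose proof (Cmod_ge_0 c1). pose proof (Cmod_ge_0 c2).
      assert (t * t <= 1) by nra. nra. }
    assert (Hm : Cmod (f (z + h) - p)%C <= Rabs M * t ^ 3).
    { rewrite Hh in HM. eapply Rle_trans; [exact HM|].
      apply Rmult_le_compat_r; [apply pow_le; lra|apply Rle_abs]. }
    assert (Cmod p * Cmod (f (z + h) - p)%C <= B * (Rabs M * t ^ 3)).
    { apply Rmult_le_compat; try apply Cmod_ge_0; assumption. }
    unfold A. lra. }
  assert (Hmod : Cmod (RtoC t) = t /\ Cmod (RtoC (- t)) = t
                 /\ Cmod (0, t) = t /\ Cmod (0, (- t)%R) = t).
  { repeat split; rewrite ?Cmod_R, ?Rabs_Ropp; try (apply Rabs_pos_eq; lra);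
      unfold Cmod; simpl; apply sqrt_lem_1; nra. }
  destruct Hmod as (m1 & m2 & m3 & m4).
  pose proof (Hdir _ m1) as D1. pose proof (Hdir _ m2) as D2.
  pose proof (Hdir _ m3) as D3. pose proof (Hdir _ m4) as D4.
  assert (Hsum :
    Cmod (c0 + c1 * RtoC t + c2 * RtoC t * RtoC t)%C ^ 2
    + Cmod (c0 + c1 * RtoC (- t) + c2 * RtoC (- t) * RtoC (- t))%C ^ 2
    + Cmod (c0 + c1 * (0, t) + c2 * (0, t) * (0, t))%C ^ 2
    + Cmod (c0 + c1 * (0, (- t)%R) + c2 * (0, (- t)%R) * (0, (- t)%R))%C ^ 2
    = 4 * Cmod c0 ^ 2 + 4 * t ^ 2 * Cmod c1 ^ 2 + 4 * t ^ 4 * Cmod c2 ^ 2).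
  { rewrite !Cmod2_alt. destruct c0, c1, c2. unfold Re, Im; simpl. ring. }
  assert (Hsum' :
    Cmod (z + RtoC t)%C ^ 2 + Cmod (z + RtoC (- t))%C ^ 2
    + Cmod (z + (0, t))%C ^ 2 + Cmod (z + (0, (- t)%R))%C ^ 2
    = 4 * Cmod z ^ 2 + 4 * t ^ 2).
  { rewrite !Cmod2_alt. destruct z. unfold Re, Im; simpl. ring. }
  rewrite Hv.
  set (G h := Cmod (f (z + h)%C) ^ 2 + eps * Cmod (z + h)%C ^ 2).
  assert (Htot : 4 * (Cmod c0 ^ 2 + eps * Cmod z ^ 2)
    < G (RtoC t) + G (RtoC (- t)) + G (0, t) + G (0, (- t)%R)).
  { assert (0 <= t ^ 2 * Cmod c1 ^ 2) by (apply Rmult_le_pos; apply pow2_ge_0).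
    assert (0 <= t ^ 4 * Cmod c2 ^ 2)
      by (apply Rmult_le_pos; [apply pow_le; lra|apply pow2_ge_0]).
    assert (t ^ 2 * (A * t) < t ^ 2 * eps).
    { apply Rmult_lt_compat_l; [apply pow_lt; lra|exact HtA]. }
    assert (0 < t ^ 3) by (apply pow_lt; lra).
    unfold G.
    assert (4 * eps * t ^ 2 - 4 * (A - 1) * t ^ 3 > 0).
    { replace (4 * eps * t ^ 2 - 4 * (A - 1) * t ^ 3)
        with (4 * (t ^ 2 * eps - t ^ 2 * (A * t)) + 4 * t ^ 3) by ring. lra. }
    nra. }
  destruct (Rlt_le_dec (Cmod c0 ^ 2 + eps * Cmod z ^ 2) (G (RtoC t))) as [L|L1];
    [exists (RtoC t); rewrite m1; split; assumption|].
  destruct (Rlt_le_dec (Cmod c0 ^ 2 + eps * Cmod z ^ 2) (G (RtoC (- t)))) as [L|L2];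
    [exists (RtoC (- t)); rewrite m2; split; assumption|].
  destruct (Rlt_le_dec (Cmod c0 ^ 2 + eps * Cmod z ^ 2) (G (0, t))) as [L|L3];
    [exists (0, t); rewrite m3; split; assumption|].
  exists (0, (- t)%R). rewrite m4. split; [assumption|]. unfold G in *. lra.
Qed.

(** * Compactness of the closed disc, attained maxima and their first-order conditions *)

Lemma Cmod_le_Rabs (z : C) : Cmod z <= Rabs (fst z) + Rabs (snd z).
Proof.
  destruct z as [x y]. simpl.
  replace ((x, y) : C) with (RtoC x + RtoC y * Ci)%C
    by (unfold RtoC, Ci, Cplus, Cmult; simpl; f_equal; ring).
  eapply Rle_trans; [apply Cmod_triangle|].
  rewrite Cmod_mult, Cmod_Ci, !Cmod_R. lra.
Qed.

(** Compactness in the form local-to-uniform: a property that persists when [d] shrinks and holds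
    locally holds with a single [d]. It follows from compactness of the enclosing square. *)
Lemma closed_disc_uniform (Q : R -> C -> Prop) (r : R) :
  (forall d d' w, 0 < d' <= d -> Q d w -> Q d' w) ->
  (forall z, Cmod z <= r ->
     exists d, 0 < d /\ forall w, Cmod w <= r -> Cmod (w - z)%C < d -> Q d w) ->
  exists d, 0 < d /\ forall w, Cmod w <= r -> Q d w.
Proof.
  intros Hmono Hloc.
  assert (Hd : forall u v, exists d : posreal, forall w, Cmod w <= r ->
    Rabs (fst w - u) < d -> Rabs (snd w - v) < d -> Q d w).
  { intros u v. destruct (Rle_lt_dec (Cmod (u, v)) r) as [Hin|Hout].
    - destruct (Hloc _ Hin) as (d & Hd & HQ).
      assert (Hd2 : 0 < d / 2) by lra. exists (mkposreal _ Hd2). simpl.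
      intros w Hw H1 H2. apply Hmono with d; [lra|]. apply HQ; [exact Hw|].
      eapply Rle_lt_trans; [apply Cmod_le_Rabs|].
      change (Rabs (fst w - u) + Rabs (snd w - v) < d). lra.
    (* A centre outside the disc gets a gauge so small that no point of the disc is near it, which
       makes the condition vacuous. *)
    - assert (Hd2 : 0 < (Cmod (u, v) - r) / 2) by lra.
      exists (mkposreal _ Hd2). simpl. intros w Hw H1 H2. exfalso.
      assert (Hwz : Cmod (w - (u, v))%C < Cmod (u, v) - r).
      { eapply Rle_lt_trans; [apply Cmod_le_Rabs|].
        change (Rabs (fst w - u) + Rabs (snd w - v) < Cmod (u, v) - r). lra. }
      pose proof (Cmod_triangle w (- (w - (u, v)))) as H.
      replace (w + - (w - (u, v)))%C with ((u, v) : C) in H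
        by (generalize ((u, v) : C); intros z; ring).
      rewrite Cmod_opp in H. lra. }
  set (delta u v := proj1_sig (constructive_indefinite_description _ (Hd u v))).
  destruct (compactness_value_2d (- r) r (- r) r delta) as [d Hcov].
  (* The covering point is only provided under a double negation, so the goal is first negated. *)
  exists d. split; [apply cond_pos|]. intros w Hw. apply NNPP. intros HnQ.
  pose proof (Rmax_Cmod w) as Hm.
  pose proof (Rmax_l (Rabs (fst w)) (Rabs (snd w))).
  pose proof (Rmax_r (Rabs (fst w)) (Rabs (snd w))).
  apply (Hcov (fst w) (snd w)).
  { apply Rabs_le_between. lra. }
  { apply Rabs_le_between. lra. }
  intros (u & v & _ & _ & H1 & H2 & Hle). apply HnQ.
  unfold delta in *.
  destruct (constructive_indefinite_description _ (Hd u v)) as [d' Hd']. simpl in *.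
  apply Hmono with d'; [|now apply Hd']. split; [apply cond_pos|exact Hle].
Qed.

(** Local-to-uniform compactness is used twice: with [G w <= / d] to bound [G], and, if the supremum
    [S] were not attained, with [G w <= S - d] to contradict its minimality. *)
Lemma closed_disc_max (G : C -> R) (r : R) :
  0 <= r ->
  (forall z e, Cmod z <= r -> 0 < e ->
     exists d, 0 < d /\ forall w, Cmod (w - z)%C < d -> G w < G z + e) ->
  exists z0, Cmod z0 <= r /\ forall z, Cmod z <= r -> G z <= G z0.
Proof.
  intros Hr Husc.
  assert (Hbd : exists d, 0 < d /\ forall w, Cmod w <= r -> G w <= / d).
  { apply (closed_disc_uniform (fun d w => G w <= / d)).
    - intros d d' w Hd H. eapply Rle_trans; [exact H|]. apply Rinv_le_contravar; lra.
    - intros z Hz. destruct (Husc z 1 Hz Rlt_0_1) as (d & Hd & H).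
      pose proof (Rabs_pos (G z)). pose proof (Rle_abs (G z)).
      exists (Rmin d (/ (Rabs (G z) + 1))).
      assert (0 < / (Rabs (G z) + 1)) by (apply Rinv_0_lt_compat; lra).
      split; [apply Rmin_pos; assumption|]. intros w _ Hw.
      pose proof (Rmin_l d (/ (Rabs (G z) + 1))).
      specialize (H w ltac:(lra)).
      apply Rle_trans with (Rabs (G z) + 1); [lra|].
      rewrite <- (Rinv_inv (Rabs (G z) + 1)) at 1.
      apply Rinv_le_contravar; [apply Rmin_pos; assumption|apply Rmin_r]. }
  destruct Hbd as (b & Hb & Hbd).
  destruct (completeness (fun x => exists z, Cmod z <= r /\ x = G z)) as [S [HS1 HS2]].
  { exists (/ b). intros x (z & Hz & ->). now apply Hbd. }
  { exists (G (RtoC 0)), (RtoC 0). rewrite Cmod_0. split; [exact Hr|reflexivity]. }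
  apply NNPP. intros Hno.
  assert (Hlt : forall z, Cmod z <= r -> G z < S).
  { intros z Hz. assert (HzS : G z <= S) by (apply HS1; now exists z).
    destruct (Rle_lt_or_eq_dec _ _ HzS) as [L|E]; [exact L|].
    exfalso. apply Hno. exists z. split; [exact Hz|]. intros w Hw. rewrite E.
    apply HS1. now exists w. }
  destruct (closed_disc_uniform (fun d w => G w <= S - d) r) as (d & Hd & H).
  - intros d d' w Hd H. lra.
  - intros z Hz. pose proof (Hlt z Hz).
    destruct (Husc z ((S - G z) / 2) Hz ltac:(lra)) as (d & Hd & H').
    exists (Rmin d ((S - G z) / 2)). split; [apply Rmin_pos; lra|].
    intros w _ Hw. pose proof (Rmin_l d ((S - G z) / 2)).
    pose proof (Rmin_r d ((S - G z) / 2)). specialize (H' w ltac:(lra)). lra.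
  - assert (S <= S - d); [|lra]. apply HS2. intros x (z & Hz & ->). now apply H.
Qed.

(* The variations [w = z (1 - t u)] with [Re u > 0] and small [t > 0] stay in the
   disc of radius [|z|]. *)
Lemma boundary_max (f : C -> C) (z c0 c1 c2 : C) (eps : R) :
  taylor2 f z c0 c1 c2 -> 0 <= eps ->
  (forall w, Cmod w <= Cmod z ->
     Cmod (f w) ^ 2 + eps * Cmod w ^ 2 <= Cmod (f z) ^ 2 + eps * Cmod z ^ 2) ->
  Im (Cconj c0 * c1 * z)%C = 0 /\ - (eps * Cmod z ^ 2) <= Re (Cconj c0 * c1 * z)%C.
Proof.
  intros HT He Hmax. rewrite (taylor2_value _ _ _ _ _ HT) in Hmax.
  destruct (taylor2_Cmod_square_ge _ _ _ _ _ HT) as (M & d & Hd & HM).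
  set (s := (Cconj c0 * c1 * z)%C). set (N := Cmod z ^ 2) in *.
  assert (HN : 0 <= N) by apply pow2_ge_0.
  (* The quantity [L] is, up to the factor -2, the derivative in [t] at 0 of the maximised function
     along [z (1 - t u)]. *)
  assert (Hu : forall u, 0 < Re u -> 0 <= Re (s * u)%C + eps * N * Re u).
  { intros u Hu. set (L := Re (s * u)%C + eps * N * Re u).
    destruct (Rle_lt_dec 0 L) as [?|HL]; [assumption|exfalso].
    set (K := Rabs M * Cmod u ^ 2 * N + 1).
    assert (HK : 1 <= K).
    { unfold K. pose proof (Rabs_pos M). pose proof (pow2_ge_0 (Cmod u)).
      pose proof (Rmult_le_pos _ _ (Rmult_le_pos _ _ H H0) HN). lra. }
    assert (Hu0 : 0 < Cmod u).
    { apply Rlt_le_trans with (Re u); [exact Hu|].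
      eapply Rle_trans; [apply Rle_abs|apply re_le_Cmod]. }
    pose proof (Cmod_ge_0 z) as Hz0.
    set (D1 := Cmod u * Cmod z + 1).
    assert (HD1 : 1 <= D1) by (unfold D1; pose proof (Rmult_le_pos _ _ (Rlt_le _ _ Hu0) Hz0); lra).
    assert (Hu2 : 0 < Cmod u ^ 2) by (apply pow_lt; lra).
    (* The three conditions keep [h] in the range of the expansion, give [|1 - t u| <= 1], and make
       the quadratic error smaller than the linear gain. *)
    assert (Ht : exists t, 0 < t /\ t * D1 < d /\ t * Cmod u ^ 2 < 2 * Re u
                           /\ t * K < - L).
    { set (m := Rmin (d / D1) (Rmin (2 * Re u / Cmod u ^ 2) (- L / K))).
      assert (Hm : 0 < m)
        by (unfold m; repeat apply Rmin_pos; apply Rdiv_lt_0_compat; lra).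
      pose proof (Rmin_l (d / D1) (Rmin (2 * Re u / Cmod u ^ 2) (- L / K))).
      pose proof (Rmin_r (d / D1) (Rmin (2 * Re u / Cmod u ^ 2) (- L / K))).
      pose proof (Rmin_l (2 * Re u / Cmod u ^ 2) (- L / K)).
      pose proof (Rmin_r (2 * Re u / Cmod u ^ 2) (- L / K)).
      fold m in H, H0. exists (m / 2).
      split; [lra|]. split; [|split].
      - apply (Rlt_div_r _ d D1); lra.
      - apply (Rlt_div_r _ (2 * Re u) (Cmod u ^ 2)); lra.
      - apply (Rlt_div_r _ (- L) K); lra. }
    destruct Ht as (t & Ht0 & Ht1 & Ht2 & Ht3).
    set (h := (RtoC (- t) * u * z)%C).
    assert (Hh : Cmod h = t * (Cmod u * Cmod z)).
    { unfold h. rewrite !Cmod_mult, Cmod_R, Rabs_Ropp, Rabs_pos_eq by lra. ring. }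
    assert (Hzh : Cmod (z + h)%C ^ 2 = N * (1 - 2 * t * Re u + t ^ 2 * Cmod u ^ 2)).
    { replace (z + h)%C with (z * (1 + RtoC (- t) * u))%C by (unfold h; ring).
      rewrite Cmod_mult, Rpow_mult_distr. fold N. f_equal.
      rewrite !Cmod2_alt. destruct u. unfold Re, Im; simpl. ring. }
    assert (Hin : Cmod (z + h)%C <= Cmod z).
    { apply Rsqr_incr_0; [|apply Cmod_ge_0|exact Hz0].
      rewrite !Rsqr_pow2, Hzh. fold N.
      assert (0 <= N * (t * (2 * Re u - t * Cmod u ^ 2)))
        by (repeat apply Rmult_le_pos; lra).
      lra. }
    specialize (HM h). rewrite Hh in HM. specialize (HM ltac:(unfold D1 in Ht1; lra)).
    specialize (Hmax _ Hin). rewrite Hzh in Hmax.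
    replace (Re (Cconj c0 * c1 * h)%C) with (- t * Re (s * u)%C) in HM.
    2:{ unfold h, s. destruct c0, c1, u, z. unfold Re; simpl. ring. }
    replace ((t * (Cmod u * Cmod z)) ^ 2) with (t * t * (Cmod u ^ 2 * N)) in HM
      by (unfold N; ring).
    assert (HU : 0 <= Cmod u ^ 2 * N) by (apply Rmult_le_pos; lra).
    assert (HMA : M * (t * t * (Cmod u ^ 2 * N)) <= t * (t * K)).
    { apply Rle_trans with (Rabs M * (t * t * (Cmod u ^ 2 * N))).
      { apply Rmult_le_compat_r; [|apply Rle_abs]. apply Rmult_le_pos; nra. }
      unfold K. nra. }
    assert (t * (t * K) < t * - L) by (apply Rmult_lt_compat_l; lra).
    assert (HeN : 0 <= eps * N * (t ^ 2 * Cmod u ^ 2)).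
    { apply Rmult_le_pos; [apply Rmult_le_pos; lra|].
      apply Rmult_le_pos; [apply pow2_ge_0|lra]. }
    assert (t * L < 0) by nra.
    unfold L in *. nra. }
  split.
  (* The nearly tangential directions [e + i] and [e - i] force [Im s = 0] as [e] tends to 0; the
     radial direction 1 then gives the bound on [Re s]. *)
  - assert (H1 : forall e, 0 < e -> Rabs (Im s) <= e * (Re s + eps * N)).
    { intros e He0. pose proof (Hu (e, 1) He0) as A. pose proof (Hu (e, -1) He0) as B.
      rewrite re_mult in A, B.
      change (0 <= Re s * e - Im s * 1 + eps * N * e) in A.
      change (0 <= Re s * e - Im s * -1 + eps * N * e) in B.
      apply Rabs_le. lra. }
    destruct (Req_dec (Im s) 0) as [?|Hne]; [assumption|exfalso].
    apply Rabs_pos_lt in Hne.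
    set (X := Rabs (Re s + eps * N) + 1).
    assert (HX : 1 <= X) by (unfold X; pose proof (Rabs_pos (Re s + eps * N)); lra).
    assert (H2 : 0 < Rabs (Im s) / X / 2).
    { apply Rdiv_lt_0_compat; [apply Rdiv_lt_0_compat; lra|lra]. }
    specialize (H1 _ H2).
    assert (Rabs (Im s) / X / 2 * (Re s + eps * N) <= Rabs (Im s) / X / 2 * X).
    { apply Rmult_le_compat_l; [lra|]. unfold X.
      pose proof (Rle_abs (Re s + eps * N)). lra. }
    replace (Rabs (Im s) / X / 2 * X) with (Rabs (Im s) / 2) in H by (field; lra).
    lra.
  - pose proof (Hu (RtoC 1) ltac:(simpl; lra)) as H.
    replace (s * RtoC 1)%C with s in H by ring. rewrite re_RtoC in H. lra.
Qed.

(** * The bound on f' - 1 *)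

(** The value of [g] at 0 is the linear coefficient, which makes [g] the shifted series near 0.
    Analyticity is claimed only there: elsewhere [g] is expanded through the quotient. *)
Lemma analytic_at_0_factor (f : C -> C) :
  analytic_at f (RtoC 0) ->
  exists g, analytic_at g (RtoC 0) /\ forall w, (f w - f (RtoC 0) = g w * w)%C.
Proof.
  intros (a & r & Hr & Hf).
  assert (Hf' : forall h, Cmod h < r -> @is_pseries C_AbsRing C_NormedModule a h (f h)).
  { intros h Hh. replace h with (h - RtoC 0)%C at 1 by ring. apply Hf.
    now replace (h - RtoC 0)%C with h by ring. }
  assert (H0 : f (RtoC 0) = a 0%nat).
  { apply (is_pseries_unique a (RtoC 0)); [|apply is_pseries_at_0].
    apply Hf'. rewrite Cmod_0. exact Hr. }
  exists (fun w => if Ceq_dec w 0 then a 1%nat else ((f w - f (RtoC 0)) / w)%C).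
  split.
  - exists (fun n => a (S n)), r. split; [exact Hr|]. intros h Hh.
    replace (h - 0)%C with h in * by ring.
    destruct (Ceq_dec h 0) as [->|Hh0].
    + apply (is_pseries_at_0 (fun n => a (S n))).
    + rewrite H0. apply is_pseries_shift; [exact Hh0|]. now apply Hf'.
  - intros w. destruct (Ceq_dec w 0) as [->|Hw]; [ring|field; exact Hw].
Qed.

Lemma taylor2_minus_const (f : C -> C) (k z c0 c1 c2 : C) :
  taylor2 f z c0 c1 c2 -> taylor2 (fun w => f w - k)%C z (c0 - k)%C c1 c2.
Proof.
  intros (M & d & Hd & H). exists M, d. split; [exact Hd|]. intros h Hh.
  replace (f (z + h) - k - (c0 - k + c1 * h + c2 * h * h))%C
    with (f (z + h) - (c0 + c1 * h + c2 * h * h))%C by ring.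
  now apply H.
Qed.

Lemma Re_Cdiv (u v : C) : v <> RtoC 0 -> Re (u / v)%C = Re (u * Cconj v)%C / Cmod v ^ 2.
Proof.
  intros Hv. apply Cmod_gt_0 in Hv.
  assert (0 < Cmod v ^ 2) by (apply pow_lt; exact Hv).
  rewrite Cmod2_alt in *. destruct u, v. unfold Re, Im in *; simpl in *.
  field. lra.
Qed.

(** With [A = |w|^2] and [x = Re w] the real part is [k (A + x) / (1 + 2 x + A)]. For [k = 1 - e]
    the claim reads [2 e (A + x) <= A - 1], and [|x| <= A] reduces it to [4 e A <= A - 1]. *)
Lemma Re_scaled_quotient_ge (w : C) (k e : R) :
  0 <= e -> 1 - e <= k -> 1 < Cmod w ^ 2 -> 1 <= Cmod w ^ 2 * (1 - 4 * e) ->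
  1 / 2 <= Re (RtoC k * w / (1 + w))%C.
Proof.
  intros He Hk HA HAe.
  assert (Hx : Re w ^ 2 <= Cmod w ^ 2).
  { rewrite Cmod2_alt. pose proof (pow2_ge_0 (Im w)). lra. }
  set (A := Cmod w ^ 2) in *. set (x := Re w) in *.
  assert (Hden : Cmod (1 + w)%C ^ 2 = 1 + 2 * x + A).
  { unfold A, x. rewrite !Cmod2_alt. destruct w. unfold Re, Im; simpl. ring. }
  assert (Hpos : 0 < 1 + 2 * x + A).
  { assert (x ^ 2 < A * A) by nra. nra. }
  assert (Hne : (1 + w)%C <> RtoC 0).
  { intros E. rewrite E, Cmod_0 in Hden. lra. }
  rewrite Re_Cdiv by exact Hne. rewrite Hden.
  replace (Re (RtoC k * w * Cconj (1 + w))%C) with (k * (A + x)).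
  2:{ unfold A, x. rewrite Cmod2_alt. destruct w. unfold Re, Im; simpl. ring. }
  apply (proj1 (Rle_div_r _ _ _ Hpos)).
  assert (HAx : 0 <= A + x) by nra.
  assert (HAx2 : A + x <= 2 * A) by nra.
  assert ((1 - e) * (A + x) <= k * (A + x)) by (apply Rmult_le_compat_r; assumption).
  nra.
Qed.

Lemma real_multiple (p q : C) (s : R) :
  p <> RtoC 0 -> (Cconj p * q = RtoC s)%C -> q = (RtoC (s / Cmod p ^ 2) * p)%C.
Proof.
  intros Hp Hs.
  assert (Hp2 : Cmod p ^ 2 <> 0) by (apply pow_nonzero, Rgt_not_eq, Cmod_gt_0; exact Hp).
  assert (HpC : (Cconj p <> 0)%C).
  { intros E. apply Hp. apply Cmod_eq_0. rewrite <- Cmod_conj, E. apply Cmod_0. }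
  rewrite RtoC_div by exact Hp2. rewrite Cmod2_conj, <- Hs. field. now split.
Qed.

Lemma Cmod_C_derive_minus_1_lt (f : C -> C) :
  classA f ->
  (forall z, in_disc z -> Re (convexity_quotient f z) < 3 / 2) ->
  forall z, in_disc z -> Cmod (C_derive f z - 1)%C < 1.
Proof.
  intros (Hf & _ & Hf1) Hconv zeta Hzeta. unfold in_disc in *.
  destruct (Rlt_le_dec (Cmod (C_derive f zeta - 1)%C) 1) as [?|Hge];
    [assumption|exfalso].
  assert (Hg : forall z, Cmod z < 1 -> analytic_at (C_derive f) z).
  { intros z Hz. now apply analytic_at_C_derive, Hf. }
  destruct (analytic_at_0_factor (C_derive f)) as (phi & Hphi0 & Hphi).
  { apply Hg. rewrite Cmod_0. lra. }
  rewrite Hf1 in Hphi.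
  assert (HT : forall z, Cmod z < 1 -> exists c0 c1 c2, taylor2 phi z c0 c1 c2).
  { intros z Hz. destruct (Ceq_dec z 0) as [->|Hz0].
    - now apply analytic_taylor2.
    - destruct (analytic_taylor2 _ _ (Hg z Hz)) as (c0 & c1 & c2 & H).
      apply (taylor2_minus_const _ (RtoC 1)) in H.
      destruct (taylor2_quotient _ phi _ _ _ _ Hz0 Hphi H) as (d2 & H').
      do 3 eexists. exact H'. }
  set (r0 := Cmod zeta) in *.
  assert (Hr0 : 0 < r0).
  { apply Cmod_gt_0. intros ->. rewrite Hf1 in Hge.
    replace (1 - 1)%C with (RtoC 0) in Hge by ring. rewrite Cmod_0 in Hge. lra. }
  set (r := (1 + r0) / 2). assert (Hr : r0 < r < 1) by (unfold r; lra).
  set (q := r ^ 2 / r0 ^ 2).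
  assert (Hr02 : 0 < r0 ^ 2) by (apply pow_lt; lra).
  assert (Hq : 1 < q) by (unfold q; apply (proj1 (Rlt_div_r _ _ _ Hr02)); nra).
  (* Chosen so that [(q - eps) * (1 - 4 * eps) = 1 + 4 * eps ^ 2], which yields the numerical
     condition of [Re_scaled_quotient_ge]. *)
  set (eps := (q - 1) / (1 + 4 * q)).
  assert (Heps : 0 < eps) by (unfold eps; apply Rdiv_lt_0_compat; lra).
  assert (Heq : eps * (1 + 4 * q) = q - 1) by (unfold eps; field; lra).
  destruct (closed_disc_max (fun z => Cmod (phi z) ^ 2 + eps * Cmod z ^ 2) r)
    as (z0 & Hz0 & Hmax).
  { lra. }
  { intros z e Hz He. destruct (HT z ltac:(lra)) as (c0 & c1 & c2 & H).
    assert (Hid : taylor2 (fun w => w) z z (RtoC 1) (RtoC 0)).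
    { exists 0, 1. split; [lra|]. intros h _.
      replace (z + h - (z + 1 * h + 0 * h * h))%C with (RtoC 0) by ring.
      rewrite Cmod_0. lra. }
    destruct (taylor2_Cmod_square_lt _ _ _ _ _ (e / 2) H ltac:(lra)) as (d1 & Hd1 & H1).
    destruct (taylor2_Cmod_square_lt _ _ _ _ _ (e / 2 / eps) Hid
      ltac:(apply Rdiv_lt_0_compat; lra)) as (d2 & Hd2 & H2).
    exists (Rmin d1 d2). split; [now apply Rmin_pos|]. intros w Hw.
    pose proof (Rmin_l d1 d2). pose proof (Rmin_r d1 d2).
    specialize (H1 (w - z)%C ltac:(lra)). specialize (H2 (w - z)%C ltac:(lra)).
    replace (z + (w - z))%C with w in H1, H2 by ring.
    rewrite (taylor2_value _ _ _ _ _ H).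
    apply (Rmult_lt_compat_l eps) in H2; [|exact Heps].
    replace (eps * (Cmod z ^ 2 + e / 2 / eps)) with (eps * Cmod z ^ 2 + e / 2) in H2
      by (field; lra).
    lra. }
  assert (Hbd : Cmod z0 = r).
  { destruct (Rle_lt_or_eq_dec _ _ Hz0) as [Hlt|?]; [exfalso|assumption].
    destruct (HT z0 ltac:(lra)) as (c0 & c1 & c2 & H).
    destruct (no_interior_max _ _ _ _ _ eps (r - Cmod z0) H Heps ltac:(lra))
      as (h & Hh & Hlt').
    pose proof (Cmod_triangle z0 h). specialize (Hmax (z0 + h)%C ltac:(lra)). lra. }
  assert (Hz0ne : z0 <> RtoC 0) by (apply Cmod_gt_0; lra).
  destruct (analytic_taylor2 _ _ (Hg z0 ltac:(lra))) as (c0 & c1 & c2 & HTg).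
  pose proof (taylor2_value _ _ _ _ _ HTg) as Hg0.
  pose proof (taylor2_C_derive _ _ _ _ _ HTg) as Hg1.
  apply (taylor2_minus_const _ (RtoC 1)) in HTg.
  destruct (taylor2_quotient _ phi _ _ _ _ Hz0ne Hphi HTg) as (d2 & HTp).
  set (w := (c0 - 1)%C) in *. set (p := (w / z0)%C) in *.
  destruct (boundary_max _ _ _ _ _ eps HTp ltac:(lra)) as [HIm HRe].
  { intros v Hv. apply Hmax. lra. }
  pose proof (taylor2_value _ _ _ _ _ HTp) as Hp.
  rewrite Hbd in HRe.
  (* Here [p = phi(z0)] and [c1 - p = z0 phi'(z0)], so [s / |p|^2] is [z0 phi'(z0) / phi(z0)], the
     excess of [k] over 1. *)
  set (s := Re (Cconj p * ((c1 - p) / z0) * z0)%C) in *.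
  assert (Hs : (Cconj p * (c1 - p) = RtoC s)%C).
  { replace (Cconj p * (c1 - p))%C with (Cconj p * ((c1 - p) / z0) * z0)%C
      by (field; exact Hz0ne).
    unfold s. revert HIm. generalize (Cconj p * ((c1 - p) / z0) * z0)%C.
    intros [x y] E. unfold Im in E. simpl in E. now rewrite E. }
  assert (Hpz : 1 / r0 ^ 2 - eps * r ^ 2 <= Cmod p ^ 2).
  { pose proof (Hmax zeta ltac:(fold r0; lra)) as Hm. fold r0 in Hm.
    rewrite Hp, Hbd in Hm.
    assert (1 / r0 ^ 2 <= Cmod (phi zeta) ^ 2).
    { apply (proj2 (Rle_div_l _ _ _ Hr02)).
      rewrite <- Rpow_mult_distr. unfold r0. rewrite <- Cmod_mult, <- Hphi.
      apply Rle_trans with (1 ^ 2); [lra|apply pow_incr; lra]. }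
    assert (0 <= eps * r0 ^ 2) by (apply Rmult_le_pos; lra). lra. }
  assert (HA : Cmod w ^ 2 = r ^ 2 * Cmod p ^ 2).
  { rewrite <- Hbd, <- Rpow_mult_distr, <- Cmod_mult. do 2 f_equal.
    unfold p. field. exact Hz0ne. }
  assert (Hr2 : 0 < r ^ 2 < 1) by (split; nra).
  assert (HAq : q - eps <= Cmod w ^ 2).
  { rewrite HA. apply (Rmult_le_compat_l (r ^ 2)) in Hpz; [|lra].
    replace (r ^ 2 * (1 / r0 ^ 2 - eps * r ^ 2)) with (q - eps * (r ^ 2 * r ^ 2)) in Hpz
      by (unfold q; field; lra).
    assert (r ^ 2 * r ^ 2 <= 1) by nra. nra. }
  assert (HA4 : 1 <= Cmod w ^ 2 * (1 - 4 * eps)).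
  { apply Rle_trans with ((q - eps) * (1 - 4 * eps)); [nra|].
    apply Rmult_le_compat_r; [|exact HAq]. nra. }
  assert (HA1 : 1 < Cmod w ^ 2) by nra.
  (* Together with [r < 1] this turns [s >= - eps r^2] into [s / |p|^2 >= - eps]. *)
  assert (Hpp : 1 < Cmod p ^ 2).
  { rewrite HA in HA1. pose proof (pow2_ge_0 (Cmod p)).
    apply Rlt_le_trans with (1 := HA1). rewrite <- (Rmult_1_l (Cmod p ^ 2)) at 2.
    apply Rmult_le_compat_r; lra. }
  assert (Hpne : p <> RtoC 0).
  { intros E. rewrite E, Cmod_0 in Hpp. lra. }
  apply (Rlt_irrefl (3 / 2)). eapply Rle_lt_trans; [|apply (Hconv z0); lra].
  unfold convexity_quotient. rewrite Hg0, Hg1.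
  replace c0 with (1 + w)%C by (unfold w; ring).
  replace (z0 * c1)%C with (RtoC (1 + s / Cmod p ^ 2) * w)%C.
  2:{ replace c1 with (p + (c1 - p))%C by ring.
      rewrite (real_multiple p (c1 - p) s Hpne Hs), RtoC_plus.
      replace w with (z0 * p)%C by (unfold p; field; exact Hz0ne). ring. }
  rewrite re_plus.
  pose proof (Re_scaled_quotient_ge w (1 + s / Cmod p ^ 2) eps) as Hfin.
  change (Re 1%C) with 1.
  enough (1 / 2 <= Re (RtoC (1 + s / Cmod p ^ 2) * w / (1 + w))%C) by lra.
  apply Hfin; [lra| |exact HA1|exact HA4].
  assert (- eps <= s / Cmod p ^ 2); [|lra].
  apply (proj1 (Rle_div_r (- eps) s (Cmod p ^ 2) ltac:(lra))). nra.
Qed.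

(** * The extremal function *)

Lemma in_disc_Re (z : C) : in_disc z -> -1 < Re z < 1.
Proof.
  intros Hz. apply Rabs_lt_between. eapply Rle_lt_trans; [apply re_le_Cmod|exact Hz].
Qed.

Lemma one_plus_neq_0 (z : C) : in_disc z -> (1 + z)%C <> RtoC 0.
Proof.
  intros Hz E. apply in_disc_Re in Hz.
  apply (f_equal Re) in E. rewrite re_plus, !re_RtoC in E. lra.
Qed.

Lemma C_derive_f0 (z : C) : C_derive f0 z = (1 + z)%C.
Proof.
  apply (C_derive_of_quadratic_error _ _ _ 1 1); [lra|]. intros w _.
  replace (f0 w - f0 z - (1 + z) * (w - z))%C with (/ 2 * ((w - z) * (w - z)))%C
    by (unfold f0; field).
  rewrite !Cmod_mult, Cmod_inv, Cmod_R, Rabs_pos_eq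
    by (try lra; intros E; apply RtoC_inj in E; lra).
  pose proof (Cmod_ge_0 (w - z)%C). nra.
Qed.

Lemma C_derive_C_derive_f0 (z : C) : C_derive (C_derive f0) z = RtoC 1.
Proof.
  apply (C_derive_of_quadratic_error _ _ _ 0 1); [lra|]. intros w _.
  rewrite !C_derive_f0.
  replace (1 + w - (1 + z) - 1 * (w - z))%C with (RtoC 0) by ring.
  rewrite Cmod_0. lra.
Qed.

Lemma analytic_at_f0 (z : C) : analytic_at f0 z.
Proof.
  exists (fun n => match n with
                   | 0%nat => f0 z | 1%nat => (1 + z)%C | 2%nat => (/ 2)%C
                   | _ => RtoC 0 end), 1.
  split; [lra|]. intros w _. apply is_pseries_C. set (h := (w - z)%C).
  replace (f0 w) with (f0 z + (h * (1 + z) + h * h * / 2))%C.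
  2:{ unfold h, f0. field. }
  apply (@is_series_decr_n C_AbsRing C_NormedModule _ 3); [lia|].
  apply (filterlim_ext (fun _ => RtoC 0)).
  { intros n. symmetry. unfold sum_n.
    rewrite (sum_n_m_ext (G := C_AbelianGroup) _ (fun _ => RtoC 0)).
    - apply (sum_n_m_const_zero (G := C_AbelianGroup)).
    - intros k. C_ring. }
  simpl pred. rewrite !sum_Sn, sum_O.
  match goal with |- filterlim _ _ (locally ?x) => replace x with (RtoC 0) end.
  - apply filterlim_const.
  - match goal with |- @eq _ ?x ?y => change (@eq C x y) end.
    change (RtoC 0 = (f0 z + (h * (1 + z) + h * h * / 2)
      - (h ^ 0 * f0 z + h ^ 1 * (1 + z) + h ^ 2 * / 2))%C).
    simpl. ring.
Qed.

(** For nonzero [v], both inequalities say [|v|^2 < 2 Re v]. *)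
Lemma Re_inv_gt_half (v : C) : Cmod (v - 1)%C < 1 -> 1 / 2 < Re (1 / v)%C.
Proof.
  intros Hv.
  assert (H2 : Cmod (v - 1)%C ^ 2 < 1).
  { pose proof (Cmod_ge_0 (v - 1)%C). nra. }
  assert (Hne : v <> RtoC 0).
  { intros ->. replace (0 - 1)%C with (- (1))%C in Hv by ring.
    rewrite Cmod_m1 in Hv. lra. }
  rewrite Re_Cdiv by exact Hne.
  assert (H : 0 < Cmod v ^ 2) by (apply pow_lt, Cmod_gt_0; exact Hne).
  apply (proj1 (Rlt_div_r _ _ _ H)).
  rewrite Cmod2_alt in *. destruct v as [x y].
  unfold Re, Im in *. simpl in *. nra.
Qed.

Lemma classA_f0 : classA f0.
Proof.
  split; [intros z _; apply analytic_at_f0|]. split.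
  - unfold f0. field.
  - rewrite C_derive_f0. ring.
Qed.

(** The quotient equals [2 - 1/(1 + z)], so the bound is the half-plane estimate at [v = 1 + z]. *)
Lemma convexity_quotient_f0_lt (z : C) :
  in_disc z -> Re (convexity_quotient f0 z) < 3 / 2.
Proof.
  intros Hz. unfold convexity_quotient.
  rewrite C_derive_C_derive_f0, C_derive_f0.
  pose proof (Re_inv_gt_half (1 + z)%C) as H.
  replace (1 + z - 1)%C with z in H by ring. specialize (H Hz).
  replace (1 + z * 1 / (1 + z))%C with (2 - 1 / (1 + z))%C
    by (field; now apply one_plus_neq_0).
  unfold Cminus. rewrite re_plus, re_opp. change (Re 2%C) with 2. lra.
Qed.

Lemma in_disc_RtoC (t : R) : 0 < t < 1 -> in_disc (RtoC t).
Proof. intros Ht. unfold in_disc. rewrite Cmod_R, Rabs_pos_eq; lra. Qed.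

Theorem theorem2p3 :
  (forall f : C -> C,
     classA f ->
     (forall z : C, in_disc z -> Re (convexity_quotient f z) < 3 / 2) ->
     (forall z : C, in_disc z -> Re (1 / C_derive f z)%C > 1 / 2) /\
     (forall z : C, in_disc z -> Cmod (C_derive f z - 1)%C < 1)) /\
  (classA f0 /\
   (forall z : C, in_disc z -> Re (convexity_quotient f0 z) < 3 / 2) /\
   is_glb_Rbar
     (fun x : R => exists z : C, in_disc z /\ x = Re (1 / C_derive f0 z)%C)
     (Finite (1 / 2)) /\
   is_lub_Rbar
     (fun x : R => exists z : C, in_disc z /\ x = Cmod (C_derive f0 z - 1)%C)
     (Finite 1)).
Proof.
  split.
  { intros f Hf Hconv. pose proof (Cmod_C_derive_minus_1_lt f Hf Hconv) as H.
    split; [|exact H]. intros z Hz. apply Re_inv_gt_half. now apply H. }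
  split; [exact classA_f0|]. split; [exact convexity_quotient_f0_lt|].
  assert (Hsub : forall z, (C_derive f0 z - 1)%C = z)
    by (intros z; rewrite C_derive_f0; ring).
  split; split.
  - intros x (z & Hz & ->). apply Rlt_le, Re_inv_gt_half. rewrite Hsub. exact Hz.
  - intros b Hb.
    assert (Hbt : forall t, 0 < t < 1 -> Rbar_le b (1 / (1 + t))).
    { intros t Ht. apply Hb. exists (RtoC t). split; [now apply in_disc_RtoC|].
      rewrite C_derive_f0, <- RtoC_plus, <- RtoC_div by lra. now rewrite re_RtoC. }
    destruct b as [b| |]; [|exact (Hbt (1 / 2) ltac:(lra))|exact I].
    simpl in *. destruct (Rle_lt_dec b (1 / 2)) as [?|L]; [assumption|exfalso].
    assert (Hb1 : b <= 1) by (pose proof (Hbt (1 / 2) ltac:(lra)); lra).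
    (* For a lower bound [b > 1/2], the point [t = 1/(2 b)] gives [b (1 + t) = b + 1/2 > 1],
       contradicting [b <= 1/(1 + t)]. *)
    assert (Ht : 0 < (/ b) / 2 < 1).
    { assert (/ b < 2) by (rewrite <- (Rinv_inv 2); apply Rinv_lt_contravar; lra).
      assert (0 < / b) by (apply Rinv_0_lt_compat; lra). lra. }
    pose proof (Hbt _ Ht) as H. apply Rle_div_r in H; [|lra].
    replace (b * (1 + / b / 2)) with (b + 1 / 2) in H by (field; lra). lra.
  - intros x (z & Hz & ->). rewrite Hsub. simpl. apply Rlt_le. exact Hz.
  - intros b Hb.
    assert (Hbt : forall t, 0 < t < 1 -> Rbar_le t b).
    { intros t Ht. apply Hb. exists (RtoC t). split; [now apply in_disc_RtoC|].
      rewrite Hsub, Cmod_R, Rabs_pos_eq; lra. }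
    destruct b as [b| |]; [|exact I|exact (Hbt (1 / 2) ltac:(lra))].
    simpl in *. destruct (Rle_lt_dec 1 b) as [?|L]; [assumption|exfalso].
    (* This gives [b >= 1/2], which places the midpoint [(1 + b)/2] in the unit interval; being
       larger than [b], it contradicts the upper bound. *)
    pose proof (Hbt (1 / 2) ltac:(lra)).
    pose proof (Hbt ((1 + b) / 2) ltac:(lra)). lra.
Qed.
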